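(* Let $(\mathfrak{h}\oplus A\oplus\mathfrak{h}^*,\bullet,\langle\;,\;\rangle_n)$ be the $\mathrm{R}$-quadratic left Leibniz algebra obtained from the quadratic Lie algebra $(A,[\;,\;]_A,\langle\;,\;\rangle_A)$ and the Lie algebra $(\mathfrak{h},[\;,\;]_{\mathfrak{h}})$ by means of $(F,\omega,\theta,\Omega)$. If $Z(A)=0$ and $H^2(A)=0$ then there exist a linear map $U:\mathfrak{h}\to A$ and a linear map $\Omega_0:\mathfrak{h}\to\wedge^2\mathfrak{h}^*$ with $\Omega_0(X)^\flat([\mathfrak{h},\mathfrak{h}]_{\mathfrak{h}})=0$ for any $X\in\mathfrak{h}$, such that $(\mathfrak{h}\oplus A\oplus\mathfrak{h}^*,\bullet,\langle\;,\;\rangle_n)$ is isomorphic to $(\mathfrak{h}\oplus A\oplus\mathfrak{h}^*,\circ,\langle\;,\;\rangle_0)$ where, for any $X,Y\in\mathfrak{h}$, $a,b\in A$, $\alpha,\beta\in\mathfrak{h}^*$, the non-vanishing products and the metric are $$X\circ Y=\Omega_0(Y)^\flat(X),\quad a\circ b=[a,b]_A+U^*([a,b]_A),\quad X\circ\alpha=(\mathrm{ad}^{\mathfrak{h}}_X)^*\alpha,$$ $$\langle X+a+\alpha,Y+b+\beta\rangle_0=\langle X+a+\alpha,Y+b+\beta\rangle_n+\langle U(X),U(Y)\rangle_A-\langle a,U(Y)\rangle_A-\langle b,U(X)\rangle_A,$$ with $U^*:A\to\mathfrak{h}^*$ defined by $U^*(a)(X)=\langle a,U(X)\rangle_A$.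
   Context: Algebras are real and finite dimensional. Left Leibniz: $u\bullet(v\bullet w)=(u\bullet v)\bullet w+v\bullet(u\bullet w)$. A metric is a nondegenerate symmetric bilinear form; a left Leibniz algebra with a metric is $\mathrm{R}$-quadratic if every right multiplication is skew-symmetric. A quadratic Lie algebra is a Lie algebra with a metric for which every $\mathrm{ad}_u$ is skew-symmetric. Isomorphic means by a linear bijection preserving product and metric. $Z(A)$ is the center and $H^2(A)$ the second cohomology of $A$ with trivial real coefficients. Notation: $\mathrm{Der}(A)$ derivations and $\mathrm{so}(A)$ skew-symmetric endomorphisms of $A$; $\langle X+a+\alpha,X+a+\alpha\rangle_n=2\alpha(X)+\langle a,a\rangle_A$; $((\mathrm{ad}^{\mathfrak{h}}_X)^*\alpha)(Y)=-\alpha([X,Y]_{\mathfrak{h}})$; for $\sigma\in\wedge^2\mathfrak{h}^*$, $((\mathrm{ad}^{\mathfrak{h}}_X)^*\sigma)(Y,Z)=-\sigma([X,Y]_{\mathfrak{h}},Z)-\sigma(Y,[X,Z]_{\mathfrak{h}})$ and $\sigma^\flat(X)(Y)=\sigma(X,Y)$. ''Non-vanishing products'' means products of elements of the summands not listed are zero. The algebra obtained from a quadratic Lie algebra $A$ and a Lie algebra $\mathfrak{h}$ with $[X,[Y,Z]_{\mathfrak{h}}]_{\mathfrak{h}}=0$ for all $X,Y,Z$, by means of $(F,\omega,\theta,\Omega)$: $F:\mathfrak{h}\to\mathrm{so}(A)\cap\mathrm{Der}(A)$ and $\Omega:\mathfrak{h}\to\wedge^2\mathfrak{h}^*$ are linear,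 $\theta,\omega:\mathfrak{h}\times\mathfrak{h}\to A$ are bilinear skew-symmetric, satisfying for all $X,Y,Z,T\in\mathfrak{h}$ $$\begin{cases} \mathrm{ad}^A_{\omega(X,Y)}=F([X,Y]_{\mathfrak{h}})-[F(X),F(Y)],\\ \mathrm{ad}^A_{\theta(X,Y)}=[F(X),F(Y)],\\ F(X)\theta(Y,Z)+F(Y)\theta(Z,X)+F(Z)\theta(X,Y)=0,\\ F(X)\omega(Y,Z)+F(Y)\omega(Z,X)-F(Z)\theta(X,Y)+\omega(X,[Y,Z]_{\mathfrak{h}})-\omega(Y,[X,Z]_{\mathfrak{h}})=0,\\ F(X)\theta(Y,Z)-F(Y)\omega(Z,X)+F(Z)\theta(X,Y)-\theta(Y,[X,Z]_{\mathfrak{h}})=0,\\ \big((\mathrm{ad}^{\mathfrak{h}}_T)^*\Omega(Z)\big)(X,Y)=\langle\omega(Y,T),\theta(X,Z)\rangle_A+\langle\omega(X,T),\theta(Z,Y)\rangle_A+\langle\theta(Z,T),\theta(X,Y)\rangle_A, \end{cases}$$ and the non-vanishing products on $\mathfrak{h}\oplus A\oplus\mathfrak{h}^*$ are $X\bullet Y=\theta(X,Y)+\Omega(Y)^\flat(X)$, $a\bullet b=[a,b]_A+\mu(a,b)$, $X\bullet a=F(X)a+\nu(X,a)$, $X\bullet\alpha=(\mathrm{ad}^{\mathfrak{h}}_X)^*\alpha$, $a\bullet X=-F(X)a+\rho(a,X)$, with $\nu(X,a)(Y)=\langle\omega(X,Y),a\rangle_A$, $\mu(a,b)(X)=\langle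 F(X)a,b\rangle_A$, $\rho(a,X)(Y)=\langle\theta(X,Y),a\rangle_A$. With the metric $\langle\;,\;\rangle_n$ this is an $\mathrm{R}$-quadratic left Leibniz algebra. *)

(* Defs.v *)
From HB Require Import structures.
From mathcomp Require Import all_boot all_order all_algebra.
From mathcomp Require Import reals.

Set Implicit Arguments.
Unset Strict Implicit.
Unset Printing Implicit Defensive.

Import GRing.Theory.
Local Open Scope ring_scope.

(* Bilinear maps V x V -> W are curried: f : 'Hom(V, 'Hom(V, W)), f x y.      *)
(* For a Lie bracket br, the endomorphism br x is therefore ad_x, and a       *)
(* 2-form s : 'Hom(V, dual V) is its own musical map s^flat.                  *)
Notation dual V := 'Hom(V, _^o).
Notation bilin V W := 'Hom(V, 'Hom(V, W)).

Section Algebra.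
Variables (R : realType) (V : vectType R).

Definition skew_bilin (W : vectType R) (f : bilin V W) :=
  forall x y, f x y = - f y x.

Record is_metric (g : 'Hom(V, dual V)) : Prop := IsMetric {
  metric_sym : forall x y, g x y = g y x;
  metric_nondeg : forall x, (forall y, g x y = 0) -> x = 0 }.

Definition skew_endo (g : 'Hom(V, dual V)) (f : 'End(V)) :=
  forall x y, g (f x) y = - g x (f y).

Definition derivation (br : bilin V V) (f : 'End(V)) :=
  forall x y, f (br x y) = br (f x) y + br x (f y).

Record is_lie (br : bilin V V) : Prop := IsLie {
  lie_alt : forall x, br x x = 0;
  lie_jacobi : forall x y z,
    br x (br y z) + br y (br z x) + br z (br x y) = 0 }.

Record is_quadratic_lie (br : bilin V V) (g : 'Hom(V, dual V)) : Prop :=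
  IsQuadraticLie {
    quadratic_lie : is_lie br;
    quadratic_metric : is_metric g;
    quadratic_ad_skew : forall x, skew_endo g (br x) }.

Definition two_step (br : bilin V V) := forall x y z, br x (br y z) = 0.

Definition in_center (br : bilin V V) (x : V) :=
  forall y, br x y = 0 /\ br y x = 0.

Definition center_trivial (br : bilin V V) := forall x, in_center br x -> x = 0.

(* Chevalley-Eilenberg differentials with trivial real coefficients. *)
Definition ce_d1 (br : bilin V V) (f : dual V) (x y : V) : R := - f (br x y).

Definition ce_d2 (br : bilin V V) (c : 'Hom(V, dual V)) (x y z : V) : R :=
  - c (br x y) z + c (br x z) y - c (br y z) x.

Definition two_cocycle (br : bilin V V) (c : 'Hom(V, dual V)) :=
  skew_bilin c /\ forall x y z, ce_d2 br c x y z = 0.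

Definition two_coboundary (br : bilin V V) (c : 'Hom(V, dual V)) :=
  exists f : dual V, forall x y, c x y = ce_d1 br f x y.

Definition H2_trivial (br : bilin V V) :=
  forall c, two_cocycle br c -> two_coboundary br c.

End Algebra.

Definition metric_isomorphic (R : realType) (V W : vectType R)
    (mulV : V -> V -> V) (gV : V -> V -> R)
    (mulW : W -> W -> W) (gW : W -> W -> R) :=
  exists phi : 'Hom(V, W),
    [/\ bijective phi,
        forall u v, phi (mulV u v) = mulW (phi u) (phi v)
      & forall u v, gW (phi u) (phi v) = gV u v].

Section Construction.
Variables (R : realType) (h A : vectType R).

Definition ext_space : vectType R := (h * A * dual h)%type.

Variables (brA : bilin A A) (gA : 'Hom(A, dual A)) (brh : bilin h h).

(* (ad_X)^* on h^* and on 2-forms. *)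
Definition coad (X : h) (alpha : dual h) : dual h := - (alpha \o brh X)%VF.

Definition coad2 (X : h) (sigma : 'Hom(h, dual h)) (Y Z : h) : R :=
  - sigma (brh X Y) Z - sigma Y (brh X Z).

(* The symmetric bilinear form polarizing                                     *)
(* <X + a + alpha, X + a + alpha>_n = 2 alpha(X) + <a, a>_A.                  *)
Definition metric_n (u v : ext_space) : R :=
  let: (X, a, alpha) := u in let: (Y, b, beta) := v in
  alpha Y + beta X + gA a b.

Section Data.
Variables (F : 'Hom(h, 'End(A))) (omega theta : bilin h A).
Variable Omega : 'Hom(h, 'Hom(h, dual h)).

Record admissible : Prop := Admissible {
  adm_F_skew : forall X, skew_endo gA (F X);
  adm_F_der : forall X, derivation brA (F X);
  adm_omega_skew : skew_bilin omega;
  adm_theta_skew : skew_bilin theta;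
  adm_Omega_skew : forall X, skew_bilin (Omega X);
  adm_ad_omega : forall X Y,
    brA (omega X Y) = F (brh X Y) - ((F X \o F Y)%VF - (F Y \o F X)%VF);
  adm_ad_theta : forall X Y,
    brA (theta X Y) = (F X \o F Y)%VF - (F Y \o F X)%VF;
  adm_theta_cycle : forall X Y Z,
    F X (theta Y Z) + F Y (theta Z X) + F Z (theta X Y) = 0;
  adm_omega_theta : forall X Y Z,
    F X (omega Y Z) + F Y (omega Z X) - F Z (theta X Y)
      + omega X (brh Y Z) - omega Y (brh X Z) = 0;
  adm_theta_omega : forall X Y Z,
    F X (theta Y Z) - F Y (omega Z X) + F Z (theta X Y)
      - theta Y (brh X Z) = 0;
  adm_Omega : forall X Y Z T,
    coad2 T (Omega Z) X Y =
      gA (omega Y T) (theta X Z) + gA (omega X T) (theta Z Y)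
        + gA (theta Z T) (theta X Y) }.

(* linfun f is f only when f is linear; see nuE, muE and rhoE. *)
Definition nu (X : h) (a : A) : dual h := linfun (fun Y => gA (omega X Y) a).
Definition mu (a b : A) : dual h := linfun (fun X => gA (F X a) b).
Definition rho (a : A) (X : h) : dual h := linfun (fun Y => gA (theta X Y) a).

Definition prod_n (u v : ext_space) : ext_space :=
  let: (X, a, alpha) := u in let: (Y, b, beta) := v in
  (0,
   theta X Y + brA a b + F X b - F Y a,
   Omega Y X + mu a b + nu X b + coad X beta + rho a Y).

Let linfun_lin (f : h -> R^o) : linear f -> linfun f =1 f.
Proof.
move=> fl; pose fL := GRing.isLinear.Build R h R^o *:%R f fl.
pose g : {linear h -> R^o} := HB.pack f fL.
by apply: (lfunE g).
Qed.

Lemma nuE X a Y : nu X a Y = gA (omega X Y) a.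
Proof.
by apply: linfun_lin => k Y1 Y2; rewrite !linearP add_lfunE scale_lfunE.
Qed.

Lemma muE a b X : mu a b X = gA (F X a) b.
Proof.
apply: linfun_lin => k X1 X2.
by rewrite linearP add_lfunE scale_lfunE linearP add_lfunE scale_lfunE.
Qed.

Lemma rhoE a X Y : rho a X Y = gA (theta X Y) a.
Proof.
by apply: linfun_lin => k Y1 Y2; rewrite !linearP add_lfunE scale_lfunE.
Qed.

End Data.

Section Reduced.
Variables (U : 'Hom(h, A)) (Omega0 : 'Hom(h, 'Hom(h, dual h))).

(* Ustar a X = <a, U X>_A *)
Definition Ustar (a : A) : dual h := (gA a \o U)%VF.

Definition prod_0 (u v : ext_space) : ext_space :=
  let: (X, a, alpha) := u in let: (Y, b, beta) := v in
  (0, brA a b, Omega0 Y X + Ustar (brA a b) + coad X beta).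

Definition metric_0 (u v : ext_space) : R :=
  let: (X, a, alpha) := u in let: (Y, b, beta) := v in
  metric_n u v + gA (U X) (U Y) - gA a (U Y) - gA b (U X).

End Reduced.
End Construction.

(* Main.v *)
Require Import Defs.
From HB Require Import structures.
From mathcomp Require Import all_boot all_order all_algebra.
From mathcomp Require Import reals ring.

Set Implicit Arguments.
Unset Strict Implicit.
Unset Printing Implicit Defensive.

Import GRing.Theory.
Local Open Scope ring_scope.

(** The data collapse onto a single linear map U : h -> A, and a shear of
h + A + h^* then removes U altogether.

A skew-symmetric derivation D of A gives the 2-cocycle <D a, b>.  As
H^2(A) = 0 and the metric identifies A with its dual, D is inner
([skew_derivation_inner]).  So F(X) = ad_(U X), with U linear because ad is
injective when Z(A) = 0.  Cancelling ad in the first two admissibility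
conditions gives theta(X, Y) = [U X, U Y] and
omega(X, Y) = U [X, Y] - [U X, U Y] ([thetaE], [omegaE]).

Modulo h^*, the elements X - U X therefore multiply A and each other to zero.
To get the products right in h^* and to keep the metric, replace a by a + U^* a
and X by X - U X - (1/2) U^* (U X).  With U^* a the product
(X - U X) (a + U^* a) vanishes; without it the h^*-component <U [X, Z], a>
(as a function of Z) would remain.  The term U^* a also makes the new copy of A
orthogonal to the elements X - U X and absorbs mu, and the quadratic term makes
the new copy of h isotropic.  In the new decomposition the metric is < , >_n
again and the products are those of the reduced algebra for the zero map
h -> A, which is the witness used in the theorem; the map U with F = ad U only
enters through the isometry [straighten] and through Omega0.

What is left is the h^*-valued product on h, with
Omega0(Y)(X, Z) = Omega(Y)(X, Z) + <U Y, [U X, U Z] - (1/2) U [X, Z]>.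
The last admissibility condition together with the Jacobi identity of A says
that Omega0(Y) is ad-invariant ([Omega0_invariant]), and an invariant 2-form on
a Lie algebra kills the derived algebra ([invariant_form_derived]). *)

(** * Bilinear maps and metrics *)

Section LinearMaps.
Variables (R : realType) (V V' W : vectType R).

Lemma linfun_linearE (f : V -> W) : linear f -> linfun f =1 f.
Proof.
move=> fl; pose fL := GRing.isLinear.Build R V W *:%R f fl.
pose g : {linear V -> W} := HB.pack f fL.
exact: (lfunE g).
Qed.

Lemma bilinDl (f : 'Hom(V, 'Hom(V', W))) x y z :
  f (x + y) z = f x z + f y z.
Proof. by rewrite linearD add_lfunE. Qed.

Lemma bilinNl (f : 'Hom(V, 'Hom(V', W))) x z : f (- x) z = - f x z.
Proof. by rewrite linearN opp_lfunE. Qed.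

Lemma bilinZl (f : 'Hom(V, 'Hom(V', W))) k x z : f (k *: x) z = k *: f x z.
Proof. by rewrite linearZ scale_lfunE. Qed.

Lemma bilinDr (f : 'Hom(V, 'Hom(V', W))) x y z :
  f x (y + z) = f x y + f x z.
Proof. exact: linearD. Qed.

Lemma bilinNr (f : 'Hom(V, 'Hom(V', W))) x z : f x (- z) = - f x z.
Proof. exact: linearN. Qed.

Lemma bilinZr (f : 'Hom(V, 'Hom(V', W))) k x z : f x (k *: z) = k *: f x z.
Proof. exact: linearZ. Qed.

Lemma half_double (x : V) : (2^-1 : R) *: x + 2^-1 *: x = x.
Proof.
have half : 2^-1 + 2^-1 = 1 :> R by field.
by rewrite -scalerDl half scale1r.
Qed.

Lemma sub_half (x : V) : x - (2^-1 : R) *: x = 2^-1 *: x.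
Proof. by rewrite -{1}[x]half_double addrK. Qed.

End LinearMaps.

Lemma lie_anti (R : realType) (L : vectType R) (br : bilin L L) :
  is_lie br -> skew_bilin br.
Proof.
move=> Ll x y; have := lie_alt Ll (x + y).
rewrite bilinDl !bilinDr !(lie_alt Ll) add0r addr0 => /eqP.
by rewrite addr_eq0 => /eqP.
Qed.

Section Metric.
Variables (R : realType) (A : vectType R) (g : 'Hom(A, dual A)).
Hypothesis g_metric : is_metric g.

Lemma metric_lker : lker g = 0%VS.
Proof.
apply/eqP; rewrite -subv0; apply/subvP => x; rewrite memv_ker memv0 => /eqP gx0.
by apply/eqP/(metric_nondeg g_metric) => y; rewrite gx0 lfunE.
Qed.

(** The metric is an injective map from A to its dual, a space of the same
dimension. *)
Lemma metric_riesz (f : dual A) : exists v, g v = f.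
Proof.
have full : limg g = fullv.
  apply/eqP; rewrite eqEdim subvf /=.
  have := limg_ker_dim g fullv.
  by rewrite metric_lker capv0 dimv0 add0n => ->; rewrite !dimvf /dim /= muln1.
by have /memv_imgP[v _ ->] : f \in limg g by [rewrite full memvf]; exists v.
Qed.

End Metric.

(** * Quadratic Lie algebras *)

Section QuadraticLie.
Variables (R : realType) (A : vectType R).
Variables (br : bilin A A) (g : 'Hom(A, dual A)).
Hypothesis Aq : is_quadratic_lie br g.
Let Al := quadratic_lie Aq.
Let gm := quadratic_metric Aq.

Lemma metric_invariant x y z : g (br x y) z = g x (br y z).
Proof.
by rewrite (lie_anti Al) bilinNl (quadratic_ad_skew Aq) opprK.
Qed.

Lemma ad_bracket x y : br (br x y) = (br x \o br y)%VF - (br y \o br x)%VF.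
Proof.
apply/lfunP => z; rewrite add_lfunE opp_lfunE !comp_lfunE.
have := lie_jacobi Al x y z.
rewrite (lie_anti Al z (br x y)) (lie_anti Al z x) !bilinNr => /eqP.
by rewrite subr_eq0 => /eqP <-.
Qed.

Lemma metric_cycle x y z : g x (br y z) = g z (br x y).
Proof. by rewrite -metric_invariant (metric_sym gm). Qed.

(** The right-hand side of the condition on Omega, for x, y, z, t the images of
X, Y, Z, T under U and p = U [T, X], q = U [T, Y].  The three products of
double brackets that omega and theta contribute cancel by the Jacobi identity
for x, y, t, once invariance has moved z alone to one side of the metric. *)
Lemma metric_brackets_sum x y z t p q :
  g (- q - br y t) (br x z) + g (- p - br x t) (br z y) + g (br z t) (br x y) =
  g z (br p y) + g z (br x q).
Proof.
rewrite !(bilinDl g, bilinNl g) (lie_anti Al z y) !(bilinNr g) (metric_cycle q).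
rewrite (metric_cycle p) (metric_cycle (br y t)) (metric_cycle (br x t)).
rewrite (metric_invariant z) (lie_anti Al q) (lie_anti Al (br y t)).
rewrite (lie_anti Al (br x t)) (lie_anti Al x t) !(bilinNr g) (bilinNr br).
have := congr1 (g z) (lie_jacobi Al x y t).
rewrite !(bilinDr g) (bilinNr g) linear0 => J.
apply/eqP; rewrite -subr_eq0 -[X in _ == X]J; apply/eqP.
by ring.
Qed.

Hypothesis ZA : center_trivial br.

Lemma ad_inj : injective br.
Proof.
move=> x y exy; apply/eqP; rewrite -subr_eq0; apply/eqP/ZA => z.
have e : br (x - y) z = 0 by rewrite bilinDl bilinNl exy subrr.
by split=> //; rewrite (lie_anti Al) e oppr0.
Qed.

Hypothesis HA : H2_trivial br.

(** Skew-symmetry and the derivation rule make <D x, y> a 2-cocycle; a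
primitive of it is of the form <v, .>, and invariance turns
<D x, y> = - <v, [x, y]> into D = - ad_v. *)
Lemma skew_derivation_inner (D : 'End(A)) :
  skew_endo g D -> derivation br D -> exists v, br v = D.
Proof.
move=> Dsk Dder; pose c : 'Hom(A, dual A) := (g \o D)%VF.
have cE x y : c x y = g (D x) y by rewrite /c comp_lfunE.
have c_skew : skew_bilin c.
  by move=> x y; rewrite !cE Dsk (metric_sym gm).
have [f fE] : two_coboundary br c.
  apply: HA; split=> // x y z; rewrite /ce_d2 !cE Dder bilinDl.
  rewrite !Dsk (metric_sym gm _ (D x)) (metric_invariant (D x)).
  rewrite (metric_invariant x (D y)) (metric_invariant x z).
  rewrite (lie_anti Al z) bilinNr.
  by ring.
have [v vE] := metric_riesz gm f; exists (- v).
apply/lfunP => x; apply/eqP; rewrite -subr_eq0; apply/eqP/(metric_nondeg gm) => y.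
rewrite bilinDl !bilinNl -cE fE /ce_d1 -vE.
by rewrite metric_invariant subrr.
Qed.

End QuadraticLie.

(** * Invariant 2-forms *)

(** The trilinear expression sigma([T, X], Y) is antisymmetric in T, X, and
invariance makes it symmetric in X, Y.  Three rounds of these two exchanges
return to the same arguments with the opposite sign. *)
Lemma invariant_form_derived (R : realType) (h : vectType R) (br : bilin h h)
    (sigma : 'Hom(h, dual h)) :
  is_lie br -> skew_bilin sigma ->
  (forall X Y Z, coad2 br X sigma Y Z = 0) ->
  forall X Y, sigma (br X Y) = 0.
Proof.
move=> hl sk inv X Y; apply/lfunP => Z; rewrite lfunE /=.
have sym T X' Y' : sigma (br T X') Y' = sigma (br T Y') X'.
  have := inv T X' Y'; rewrite /coad2 (sk X') opprK => /eqP.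
  by rewrite addrC subr_eq0 => /eqP.
have alt T X' Y' : sigma (br T X') Y' = - sigma (br X' T) Y'.
  by rewrite (lie_anti hl) bilinNl.
have : sigma (br X Y) Z = - sigma (br X Y) Z.
  by rewrite [LHS]alt sym alt sym alt sym !opprK.
by move/eqP; rewrite eq_sym Num.Theory.eqNr => /eqP.
Qed.

(** * Straightening the extension *)

Section Reduction.
Variables (R : realType) (h A : vectType R).
Variables (brA : bilin A A) (gA : 'Hom(A, dual A)) (brh : bilin h h).
Variables (F : 'Hom(h, 'End(A))) (omega theta : bilin h A).
Variable Omega : 'Hom(h, 'Hom(h, dual h)).
Hypothesis Aq : is_quadratic_lie brA gA.
Let Al := quadratic_lie Aq.
Let gm := quadratic_metric Aq.
Hypothesis hl : is_lie brh.
Hypothesis h2 : two_step brh.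
Hypothesis adm : admissible brA gA brh F omega theta Omega.
Hypothesis ZA : center_trivial brA.

(** The right inverse of ad on its range turns the pointwise choice of v into a
linear one. *)
Lemma inner_derivation_map :
  (forall X, exists v, brA v = F X) ->
  exists U : 'Hom(h, A), forall X, F X = brA (U X).
Proof.
move=> inner; exists (brA^-1 \o F)%VF => X; rewrite comp_lfunE limg_lfunVK //.
by have [v <-] := inner X; rewrite memv_img ?memvf.
Qed.

Variable U : 'Hom(h, A).
Hypothesis FU : forall X, F X = brA (U X).

Lemma thetaE X Y : theta X Y = brA (U X) (U Y).
Proof.
apply: (ad_inj Aq ZA).
by rewrite (adm_ad_theta adm) !FU -(ad_bracket Aq).
Qed.

Lemma omegaE X Y : omega X Y = U (brh X Y) - brA (U X) (U Y).
Proof.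
apply: (ad_inj Aq ZA).
by rewrite (adm_ad_omega adm) !FU -(ad_bracket Aq) [RHS]linearB.
Qed.

(** The A-valued 2-form that corrects Omega: [kappaE] gives its value in terms
of U, but this form shows at once that it is bilinear. *)
Definition kappa : bilin h A := 2^-1 *: (theta - omega).

Lemma kappaE X Y : kappa X Y = brA (U X) (U Y) - 2^-1 *: U (brh X Y).
Proof.
rewrite /kappa !(scale_lfunE, add_lfunE, opp_lfunE) thetaE omegaE.
by rewrite opprB addrA scalerBr scalerDr half_double.
Qed.

Definition Omega0 : 'Hom(h, 'Hom(h, dual h)) :=
  Omega + linfun (fun Y => linfun (fun X => (gA (U Y) \o kappa X)%VF)).

Lemma Omega0E Y X Z : Omega0 Y X Z = Omega Y X Z + gA (U Y) (kappa X Z).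
Proof.
have lin1 Y' : linear (fun X => (gA (U Y') \o kappa X)%VF).
  by move=> k X1 X2; rewrite linearP /= comp_lfunDr -comp_lfunZr.
have lin2 : linear (fun Y => linfun (fun X => (gA (U Y) \o kappa X)%VF)).
  move=> k Y1 Y2; apply/lfunP => X'.
  rewrite add_lfunE scale_lfunE !(linfun_linearE (lin1 _)).
  by rewrite (linearP U) (linearP gA) comp_lfunDl -comp_lfunZl.
by rewrite !add_lfunE (linfun_linearE lin2) (linfun_linearE (lin1 _)) comp_lfunE.
Qed.

Lemma Omega0_skew Y : skew_bilin (Omega0 Y).
Proof.
move=> X Z; rewrite !Omega0E (adm_Omega_skew adm) !kappaE.
by rewrite (lie_anti Al) (lie_anti hl) linearN scalerN -opprD bilinNr opprD.
Qed.

(** The summand (1/2) U [X, Z] of kappa drops out because triple brackets in h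
vanish. *)
Lemma Omega0_invariant X Y Z T : coad2 brh T (Omega0 Z) X Y = 0.
Proof.
have h2' x y z : brh (brh x y) z = 0 by rewrite (lie_anti hl) h2 oppr0.
have := adm_Omega adm X Y Z T.
rewrite /coad2 !Omega0E !kappaE h2 h2' linear0 scaler0 !subr0.
rewrite !thetaE !omegaE (lie_anti hl Y) (lie_anti hl X T) !(linearN U).
rewrite (metric_brackets_sum Aq) => OmegaZ.
by rewrite !opprD addrACA OmegaZ -opprD subrr.
Qed.

Lemma Omega0_derived X Y Z : Omega0 X (brh Y Z) = 0.
Proof.
apply: (invariant_form_derived hl); first exact: Omega0_skew.
by move=> T Y' Z'; apply: Omega0_invariant.
Qed.

(** Coordinates in the decomposition by X - U X - (1/2) U^* (U X), a + U^* a
and h^*.  The coefficient 1/2 is what compensates <U X, U X> in the metric. *)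
Definition straighten (u : ext_space h A) : ext_space h A :=
  let: (X, a, alpha) := u in
  (X, a + U X, alpha - Ustar gA U (a + 2^-1 *: U X)).

Definition unstraighten (u : ext_space h A) : ext_space h A :=
  let: (X, a, alpha) := u in
  (X, a - U X, alpha + Ustar gA U (a - 2^-1 *: U X)).

Lemma Ustar_linear : linear (Ustar gA U).
Proof. by move=> k a b; rewrite /Ustar linearP /= comp_lfunDl -comp_lfunZl. Qed.

Lemma UstarE a Z : Ustar gA U a Z = gA a (U Z).
Proof. by rewrite /Ustar comp_lfunE. Qed.

Lemma straighten_linear : linear straighten.
Proof.
move=> k [[X a] al] [[Y b] be]; rewrite /straighten /=.
congr (_, _, _).
  by rewrite (linearP U) /= scalerDr addrACA.
have -> : k *: a + b + 2^-1 *: U (k *: X + Y)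
          = k *: (a + 2^-1 *: U X) + (b + 2^-1 *: U Y).
  by rewrite (linearP U) /= !scalerDr !scalerA mulrC addrACA.
by rewrite Ustar_linear /= scalerBr opprD addrACA.
Qed.

Lemma straightenK : cancel straighten unstraighten.
Proof.
move=> [[X a] al]; rewrite /straighten /unstraighten addrK.
by rewrite -[a + _ - _]addrA sub_half subrK.
Qed.

Lemma unstraightenK : cancel unstraighten straighten.
Proof.
move=> [[X a] al]; rewrite /straighten /unstraighten subrK.
by rewrite -[a - _ + _]addrA [- U X + _]addrC -[_ - U X]opprB sub_half addrK.
Qed.

Lemma straighten_isometry u v :
  metric_0 gA 0 (straighten u) (straighten v) = metric_n gA u v.
Proof.
case: u v => [[X a] al] [[Y b] be]; rewrite /metric_0 /metric_n /straighten.
rewrite !lfunE /= !opp_lfunE !UstarE !(linear0 (gA _)).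
rewrite !(bilinDl gA) !(bilinZl gA) !(bilinDr gA).
rewrite (metric_sym gm b) (metric_sym gm (U Y)).
rewrite /GRing.scale /=.
by field.
Qed.

(** The A-components agree by expanding [a + U X, b + U Y].  In h^*, invariance
brings every bracket term to the form <U Z, [ , ]>; the coadjoint action on the
corrections U^* b and (1/2) U^* (U Y) yields the terms in U [X, Z]. *)
Lemma straighten_mul u v :
  straighten (prod_n brA gA brh F omega theta Omega u v) =
  prod_0 brA gA brh 0 Omega0 (straighten u) (straighten v).
Proof.
case: u v => [[X a] al] [[Y b] be]; rewrite /prod_0 /prod_n /straighten.
rewrite [Ustar gA 0 _]comp_lfun0r linear0 scaler0 !addr0.
have -> : theta X Y + brA a b + F X b - F Y a = brA (a + U X) (b + U Y).
  rewrite thetaE !FU (lie_anti Al (U Y)) opprK.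
  rewrite (bilinDl brA) !(bilinDr brA) [_ + brA a b]addrC -!addrA.
  by congr (_ + _); rewrite addrC -addrA addrCA.
congr (_, _, _).
apply/lfunP => Z.
(* Omega0 is itself a sum, which the expansion of sums must leave folded. *)
have := Omega0E Y X Z; rewrite kappaE.
move: (Omega0 Y X) => Omega0YX Omega0YXE.
rewrite !(add_lfunE, opp_lfunE) Omega0YXE !UstarE nuE muE rhoE.
rewrite omegaE thetaE FU !comp_lfunE add_lfunE opp_lfunE UstarE.
rewrite !(bilinDl brA) !(bilinDr brA) !(bilinDl gA) !(bilinNl gA).
rewrite !(bilinDr gA) (bilinNr gA) (bilinZr gA) (bilinZl gA).
rewrite (metric_invariant Aq (U Z)) !(metric_sym gm _ (U Z)).
rewrite !(metric_sym gm (brA _ (U Z))) !(metric_cycle Aq _ _ (U Z)).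
rewrite (lie_anti Al b) (lie_anti Al (U Y)) !(bilinNr gA) (metric_sym gm b).
rewrite /GRing.scale /=.
by field.
Qed.

End Reduction.

Theorem theorem6p2 (R : realType) (h A : vectType R)
    (brA : bilin A A) (gA : 'Hom(A, dual A)) (brh : bilin h h)
    (F : 'Hom(h, 'End(A))) (omega theta : bilin h A)
    (Omega : 'Hom(h, 'Hom(h, dual h))) :
  is_quadratic_lie brA gA ->
  is_lie brh ->
  two_step brh ->
  admissible brA gA brh F omega theta Omega ->
  center_trivial brA ->
  H2_trivial brA ->
  exists (U : 'Hom(h, A)) (Omega0 : 'Hom(h, 'Hom(h, dual h))),
    [/\ forall X, skew_bilin (Omega0 X),
        forall X Y Z, Omega0 X (brh Y Z) = 0
      & metric_isomorphic
          (prod_n brA gA brh F omega theta Omega) (metric_n gA)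
          (prod_0 brA gA brh U Omega0) (metric_0 gA U)].
Proof.
move=> Aq hl h2 adm ZA HA.
have inner X : exists v, brA v = F X.
  apply: (skew_derivation_inner Aq HA); first exact: (adm_F_skew adm).
  exact: (adm_F_der adm).
have [U FU] := inner_derivation_map inner.
exists 0, (Omega0 gA omega theta Omega U); split.
- exact: (Omega0_skew Aq hl adm ZA FU).
- exact: (Omega0_derived Aq hl h2 adm ZA FU).
exists (linfun (straighten gA U)); split.
- exists (unstraighten gA U) => u; rewrite linfun_linearE;
    by [apply: straightenK | apply: unstraightenK | apply: straighten_linear].
- move=> u v; rewrite !(linfun_linearE (straighten_linear _ _)).
  exact: (straighten_mul Aq adm ZA FU).
move=> u v; rewrite !(linfun_linearE (straighten_linear _ _)).
exact: (straighten_isometry Aq).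
Qed.
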